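(* Let $f:\mathbb{R}^d\to\mathbb{R}$ be differentiable with a global minimizer $w_*$. Suppose that $f$ is $\nu$-QG ($\nu>0$) and $\hat\rho$-quasar convex ($\hat\rho>0$) with respect to $w_*$. Then for any $0<\theta<1$, $f$ is also $\left(\rho=\hat\rho\theta,\ \mu=\frac{\nu(1-\theta)}{\theta}\right)$-strongly quasar convex.
   Context: Norms and inner products on $\mathbb{R}^d$ are Euclidean; all notions are with respect to the global minimizer $w_*$. $\nu$-QG (quadratic growth): $f(w)-f(w_* )\ge\frac\nu2\|w-w_*\|^2$ for all $w\in\mathbb{R}^d$. $\rho$-quasar convexity ($\rho>0$): $f(w_* )\ge f(w)+\frac1\rho\langle\nabla f(w),w_*-w\rangle$ for all $w\in\mathbb{R}^d$. $(\rho,\mu)$-strong quasar convexity ($\rho,\mu>0$): $f(w_* )\ge f(w)+\frac1\rho\langle\nabla f(w),w_*-w\rangle+\frac\mu2\|w_*-w\|^2$ for all $w\in\mathbb{R}^d$. *)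

(* Defs.v *)
From mathcomp Require Import all_boot all_order all_algebra.
From mathcomp Require Import all_classical all_reals all_analysis.

Set Implicit Arguments.
Unset Strict Implicit.
Unset Printing Implicit Defensive.

Import Order.TTheory GRing.Theory Num.Theory.
Import numFieldNormedType.Exports.

Local Open Scope ring_scope.

Definition inner (R : realType) (d : nat) (u v : 'rV[R]_d) : R :=
  \sum_(i < d) u 0 i * v 0 i.

(* The library norm `|u| on row vectors is the sup norm, hence this separate
   Euclidean norm; both induce the same notion of differentiability. *)
Definition norm2 (R : realType) (d : nat) (u : 'rV[R]_d) : R :=
  Num.sqrt (inner u u).

Definition gradient (R : realType) (d : nat) (f : 'rV[R]_d -> R)
    (w : 'rV[R]_d) : 'rV[R]_d :=
  \row_(i < d) 'D_(delta_mx 0 i) f w.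

Lemma diff_gradient (R : realType) (d : nat) (f : 'rV[R]_d -> R)
    (w v : 'rV[R]_d) :
  differentiable f w -> 'd f w v = inner (gradient f w) v.
Proof.
move=> df; rewrite [in LHS](row_sum_delta v) linear_sum /=.
by apply: eq_bigr => i _; rewrite linearZ /= mxE deriveE// mulrC.
Qed.

Definition global_minimizer (R : realType) (d : nat) (f : 'rV[R]_d -> R)
    (wstar : 'rV[R]_d) : Prop :=
  forall w, f wstar <= f w.

Definition quadratic_growth (R : realType) (d : nat) (f : 'rV[R]_d -> R)
    (wstar : 'rV[R]_d) (nu : R) : Prop :=
  0 < nu /\
  forall w, f w - f wstar >= nu / 2 * norm2 (w - wstar) ^+ 2.

Definition quasar_convex (R : realType) (d : nat) (f : 'rV[R]_d -> R)
    (wstar : 'rV[R]_d) (rho : R) : Prop :=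
  0 < rho /\
  forall w, f wstar >= f w + rho^-1 * inner (gradient f w) (wstar - w).

Definition strongly_quasar_convex (R : realType) (d : nat)
    (f : 'rV[R]_d -> R) (wstar : 'rV[R]_d) (rho mu : R) : Prop :=
  [/\ 0 < rho, 0 < mu &
    forall w, f wstar >= f w + rho^-1 * inner (gradient f w) (wstar - w)
                         + mu / 2 * norm2 (wstar - w) ^+ 2].

(* Main.v *)
Require Import Defs.
From mathcomp Require Import all_boot all_order all_algebra.
From mathcomp Require Import all_classical all_reals all_analysis.
From mathcomp Require Import ring.
Import Order.TTheory GRing.Theory Num.Theory.
Import numFieldNormedType.Exports.
Local Open Scope ring_scope.

(** Write [D] for the gap [f w - f wstar], [a] for the inner product of the
    gradient with [wstar - w] divided by [rhohat], and [N] for the squared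
    distance to the minimizer.  Quasar convexity says [a <= - D], so dividing
    [a] by [theta < 1] overshoots: [a / theta <= - D / theta], which is
    [- D - (1 - theta) / theta * D].  The surplus [(1 - theta) / theta * D]
    pays for the quadratic term, because quadratic growth bounds [D] below by
    [nu / 2 * N].  The argument is pointwise in [w] and takes place entirely
    in [R]; this scalar part is [trade_gap_for_quadratic]. *)

Lemma norm2_distC (R : realType) (d : nat) (u v : 'rV[R]_d) :
  norm2 (u - v) = norm2 (v - u).
Proof.
rewrite /norm2 /inner; congr (Num.sqrt _).
by apply: eq_bigr => i _; rewrite -(opprB v u) mxE mulrNN.
Qed.

(** The slack of the conclusion is [theta^-1] times a combination, with weights
    [1] and [1 - theta], of the slacks of the two hypotheses. *)
Lemma trade_gap_for_quadratic (R : realFieldType) (x y a nu N theta : R) :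
  0 < theta -> theta <= 1 ->
  y + a <= x -> nu / 2 * N <= y - x ->
  y + theta^-1 * a + nu * (1 - theta) / theta / 2 * N <= x.
Proof.
move=> theta_gt0 theta_le1 quasar growth; rewrite -subr_ge0.
have -> : x - (y + theta^-1 * a + nu * (1 - theta) / theta / 2 * N) =
    theta^-1 * ((x - (y + a)) + (1 - theta) * (y - x - nu / 2 * N)).
  by field; rewrite gt_eqF.
apply: mulr_ge0; first by rewrite invr_ge0 ltW.
by apply: addr_ge0; [|apply: mulr_ge0]; rewrite subr_ge0.
Qed.

Theorem lemma7 (R : realType) (d : nat) (f : 'rV[R]_d -> R)
    (wstar : 'rV[R]_d) (nu rhohat theta : R)
    (f_diff : forall w : 'rV[R]_d, differentiable f w)
    (f_min : global_minimizer f wstar)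
    (nu_gt0 : 0 < nu) (f_QG : quadratic_growth f wstar nu)
    (rhohat_gt0 : 0 < rhohat) (f_QC : quasar_convex f wstar rhohat)
    (theta_gt0 : 0 < theta) (theta_lt1 : theta < 1) :
  strongly_quasar_convex f wstar (rhohat * theta) (nu * (1 - theta) / theta).
Proof.
case: f_QG f_QC => _ growth [_ quasar]; split.
- exact: mulr_gt0.
- by rewrite divr_gt0 // mulr_gt0 // subr_gt0.
move=> w; rewrite invfM (mulrC rhohat^-1) -(mulrA theta^-1) norm2_distC.
exact: (trade_gap_for_quadratic _ _ _ _ _ _ _ theta_gt0 (ltW theta_lt1)
  (quasar w) (growth w)).
Qed.
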